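(* Let $A: L^2(0,1)\to\ell^2$ be the bounded linear operator $[Ax]_j=\int_0^1 t^{j-1}x(t)\,dt$, $j=1,2,\dots$. Then the operator equation $Ax=y$ is ill-posed of type I in the sense of Nashed; that is, the range $\mathcal{R}(A)$ is not closed in $\ell^2$, and $\mathcal{R}(A)$ contains an infinite-dimensional closed subspace of $\ell^2$.
   Context: $L^2(0,1)$ is the real Hilbert space of square integrable functions on $(0,1)$; $\ell^2$ is the real Hilbert space of square summable sequences $(y_j)_{j=1}^\infty$. It is known (and may be assumed) that $A$ is a well-defined, injective, bounded linear operator from $L^2(0,1)$ to $\ell^2$ with norm $\sqrt{\pi}$ and dense range. Definition (Nashed): For a bounded linear operator $A:X\to Y$ between Hilbert spaces, the equation $Ax=y$ is called ill-posed if $\mathcal{R}(A)$ is not closed in $Y$. In the ill-posed case it is called ill-posed of type I if $\mathcal{R}(A)$ contains an infinite-dimensional closed subspace of $Y$, and of type II otherwise. *)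

(* Defs.v *)
From HB Require Import structures.
From mathcomp Require Import all_boot all_order all_algebra.
From mathcomp Require Import all_classical all_reals all_analysis.
From mathcomp Require Import measurable_realfun ess_sup_inf.
From mathcomp Require Import ring lra.

Set Implicit Arguments.
Unset Strict Implicit.
Unset Printing Implicit Defensive.
Import Order.TTheory GRing.Theory Num.Theory numFieldNormedType.Exports.
Local Open Scope classical_set_scope.
Local Open Scope ring_scope.

(* The library's LspaceType (classes of p-integrable functions modulo a.e.
   equality) comes without vector space structure; its normed module structure
   is set up here, with norm 'N[mu]_p. The coercion of a class to a function
   picks an arbitrary representative. *)
Section Lspace_normed_module.
Context d (T : measurableType d) (R : realType).
Variables (mu : {measure set T -> \bar R}) (p : \bar R) (p1 : (1 <= p)%E).
Implicit Types (f g : LfunType mu p1) (x y z : LspaceType mu p1).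
Local Open Scope quotient_scope.

Lemma measurable_Lspace x : measurable_fun [set: T] (x : T -> R).
Proof.
exact: (@measurable_funPT _ _ _ _
  (repr (x : {mfun_ mu, T >-> measurableTypeR R}))).
Qed.

Lemma Lspace_in_Lfun x : (x : T -> R) \in Lfun mu p.
Proof.
apply/andP; split; rewrite inE; first exact: measurable_Lspace.
exact: Lebesgue_finite.
Qed.

Definition Lspace_repr x : LfunType mu p1 := Lfun_Sub p1 (Lspace_in_Lfun x).

Lemma ae_eq_Lnorm (f g : T -> R) :
  measurable_fun [set: T] f -> measurable_fun [set: T] g ->
  f = g %[ae mu] -> ('N[mu]_p[EFin \o f] = 'N[mu]_p[EFin \o g])%E.
Proof.
move=> mf mg fg; rewrite unlock /Lnorm; case: p p1 => [r r1||//].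
- have mr (h : T -> R) : measurable_fun [set: T] h ->
      measurable_fun [set: T] (fun t => `|(EFin \o h) t| `^ r)%E.
    move=> mh; apply: (@measurableT_comp _ _ _ _ _ _ (fun y : \bar R => y `^ r)%E).
      exact: (measurable_poweR _).
    exact/measurableT_comp/measurable_EFinP.
  congr (_ `^ _)%E; apply: ge0_ae_eq_integral => //.
  + by apply: mr.
  + by apply: mr.
  + by move=> t _; exact: poweR_ge0.
  + by move=> t _; exact: poweR_ge0.
  + by apply: filterS fg => t /= h _; rewrite h.
- move=> _; case: ifPn => // mu0; apply: eq_ess_sup.
  by apply: filterS fg => t /= ->.
Qed.

Let Lfun_mfun f : {mfun T >-> measurableTypeR R} :=
  @mfun_Sub _ _ T (measurableTypeR R) f (mem_set (@measurable_funPT _ _ _ _ f)).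

Let class_mfun f : @aeEqMfun _ _ R T (measurableTypeR R) mu :=
  \pi_(@aeEqMfun _ _ R T (measurableTypeR R) mu) (Lfun_mfun f).

Let class_mfunE f : (class_mfun f : T -> R) = f %[ae mu].
Proof. by have /eqmodP/asboolP := reprK (class_mfun f). Qed.

Let class_mfun_finite f : finite_norm mu p (class_mfun f).
Proof.
rewrite /finite_norm (ae_eq_Lnorm _ _ (class_mfunE f)) //.
  exact: Lfunction_finite.
exact: (@measurable_funPT _ _ _ _ (repr (class_mfun f))).
Qed.

Definition Lspace_class f : LspaceType mu p1 :=
  HB.pack_for (LspaceType mu p1) (class_mfun f)
    (@isFinLebesgue.Build d T R mu p p1 (class_mfun f) (class_mfun_finite f)).

Lemma Lspace_classE f : (Lspace_class f : T -> R) = f %[ae mu].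
Proof. exact: class_mfunE. Qed.

Lemma LspaceP x y : (x : T -> R) = y %[ae mu] <-> x = y.
Proof.
split=> [|->]; last exact: ae_eq_refl.
case: x y => [x [[fx]]] [y [[fy]]] /= xy.
have e : x = y by rewrite -[x]reprK -[y]reprK; exact/eqmodP/asboolP.
by move: fx fy; rewrite e => fx fy; rewrite (Prop_irrelevance fx fy).
Qed.

Let Lspace_zero := Lspace_class 0.
Let Lspace_opp x := Lspace_class (- Lspace_repr x).
Let Lspace_add x y := Lspace_class (Lspace_repr x + Lspace_repr y).
Let Lspace_scale (a : R) x := Lspace_class (a *: Lspace_repr x).

Let zeroE : (Lspace_zero : T -> R) = (fun=> 0) %[ae mu].
Proof. exact: Lspace_classE. Qed.
Let oppE x : (Lspace_opp x : T -> R) = (fun t => - x t) %[ae mu].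
Proof. exact: Lspace_classE. Qed.
Let addE x y : (Lspace_add x y : T -> R) = (fun t => x t + y t) %[ae mu].
Proof. exact: Lspace_classE. Qed.
Let scaleE a x : (Lspace_scale a x : T -> R) = (fun t => a * x t) %[ae mu].
Proof. exact: Lspace_classE. Qed.

Let Lspace_addA : associative Lspace_add.
Proof.
move=> x y z; apply/LspaceP.
have e1 := addE x (Lspace_add y z); have e2 := addE y z.
have e3 := addE (Lspace_add x y) z; have e4 := addE x y.
apply: filterS3 e1 e2 (filterI e3 e4) => t /= h1 h2 [h3 h4] _.
by rewrite h1// h2// h3// h4// addrA.
Qed.

Let Lspace_addC : commutative Lspace_add.
Proof.
move=> x y; apply/LspaceP; have e1 := addE x y; have e2 := addE y x.
by apply: filterS2 e1 e2 => t /= h1 h2 _; rewrite h1// h2// addrC.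
Qed.

Let Lspace_add0 : left_id Lspace_zero Lspace_add.
Proof.
move=> x; apply/LspaceP; have e1 := addE Lspace_zero x; have e2 := zeroE.
by apply: filterS2 e1 e2 => t /= h1 h2 _; rewrite h1// h2// add0r.
Qed.

Let Lspace_addN : left_inverse Lspace_zero Lspace_opp Lspace_add.
Proof.
move=> x; apply/LspaceP.
have e1 := addE (Lspace_opp x) x; have e2 := oppE x; have e3 := zeroE.
by apply: filterS3 e1 e2 e3 => t /= h1 h2 h3 _; rewrite h1// h2// h3// addNr.
Qed.

HB.instance Definition _ := gen_eqMixin (LspaceType mu p1).
HB.instance Definition _ := gen_choiceMixin (LspaceType mu p1).
HB.instance Definition _ := GRing.isZmodule.Build (LspaceType mu p1)
  Lspace_addA Lspace_addC Lspace_add0 Lspace_addN.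

Let Lspace_scaleA a b x :
  Lspace_scale a (Lspace_scale b x) = Lspace_scale (a * b) x.
Proof.
apply/LspaceP; have e1 := scaleE a (Lspace_scale b x).
have e2 := scaleE b x; have e3 := scaleE (a * b) x.
by apply: filterS3 e1 e2 e3 => t /= h1 h2 h3 _; rewrite h1// h2// h3// mulrA.
Qed.

Let Lspace_scale1 : left_id 1 Lspace_scale.
Proof.
move=> x; apply/LspaceP; have e := scaleE 1 x.
by apply: filterS e => t /= h _; rewrite h// mul1r.
Qed.

Let Lspace_scaleDr : right_distributive Lspace_scale +%R.
Proof.
move=> a x y; apply/LspaceP.
have e1 := scaleE a (x + y); have e2 := addE x y.
have e3 := addE (Lspace_scale a x) (Lspace_scale a y).
have e4 := scaleE a x; have e5 := scaleE a y.
apply: filterS3 e1 e2 (filterI e3 (filterI e4 e5)) => t /= h1 h2 [h3 [h4 h5]] _.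
by rewrite h1// h2// h3// h4// h5// mulrDr.
Qed.

Let Lspace_scaleDl x : {morph Lspace_scale^~ x : a b / a + b}.
Proof.
move=> a b; apply/LspaceP.
have e1 := scaleE (a + b) x; have e3 := addE (Lspace_scale a x) (Lspace_scale b x).
have e4 := scaleE a x; have e5 := scaleE b x.
apply: filterS3 e1 e3 (filterI e4 e5) => t /= h1 h3 [h4 h5] _.
by rewrite h1// h3// h4// h5// mulrDl.
Qed.

HB.instance Definition _ := GRing.Zmodule_isLmodule.Build R (LspaceType mu p1)
  Lspace_scaleA Lspace_scale1 Lspace_scaleDr Lspace_scaleDl.

Lemma Lspace_addE x y : (x + y : T -> R) = (fun t => x t + y t) %[ae mu].
Proof. exact: addE. Qed.

Lemma Lspace_scaleE a x :
  ((a *: x : LspaceType mu p1) : T -> R) = (fun t => a * x t) %[ae mu].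
Proof. exact: scaleE. Qed.

Definition Lspace_norm x : R := fine 'N[mu]_p[EFin \o (x : T -> R)].

Let Lspace_norm_class f : Lspace_norm (Lspace_class f) = fine 'N[mu]_p[EFin \o f].
Proof.
congr fine; apply: ae_eq_Lnorm; last exact: Lspace_classE.
  exact: measurable_Lspace.
exact: measurable_funPT.
Qed.

Let Lspace_normD x y : Lspace_norm (x + y) <= Lspace_norm x + Lspace_norm y.
Proof. by rewrite Lspace_norm_class; exact: (ler_LnormD (Lspace_repr x)). Qed.

Let Lspace_normZ a x : Lspace_norm (a *: x) = `|a| * Lspace_norm x.
Proof.
rewrite Lspace_norm_class (LnormZ (Lspace_repr x) a) fineM//.
by rewrite -finite_norm_fine.
Qed.

Let Lspace_norm0_eq0 x : Lspace_norm x = 0 -> x = 0.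
Proof.
move=> /(@fine_Lnormr_eq0 _ _ _ _ _ _ (Lspace_repr x)) x0; apply/LspaceP.
have e := zeroE; apply: filterS2 x0 e => t /= h1 h2 _.
by rewrite h1// h2.
Qed.

HB.instance Definition _ := Lmodule_isNormed.Build R (LspaceType mu p1)
  Lspace_normD Lspace_normZ Lspace_norm0_eq0.

Lemma Lspace_normE x : `|x| = fine 'N[mu]_p[EFin \o (x : T -> R)].
Proof. by []. Qed.
End Lspace_normed_module.

Section square_integrable.
Context d (T : measurableType d) (R : realType).
Variable (mu : {measure set T -> \bar R}).

Lemma Lnorm2_sqr (f : T -> R) :
  ('N[mu]_2[EFin \o f] ^+ 2 = \int[mu]_t (f t ^+ 2)%:E)%E.
Proof.
have -> : (\int[mu]_t (f t ^+ 2)%:E = \int[mu]_t `|(EFin \o f) t| `^ 2)%E.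
  by apply: eq_integral => t _; rewrite /= powR_mulrn// real_normK// num_real.
rewrite -poweR_Lnorm//; move: (Lnorm_ge0 mu 2%:E (EFin \o f)).
case: ('N[mu]_2[_])%E => [r||] //= r0.
  by rewrite powR_mulrn// -lee_fin.
by rewrite pnatr_eq0 mulyy.
Qed.

Lemma Lspace2_norm_sqr (x : LspaceType mu (lee1n 2)) :
  ((`|x| ^+ 2)%:E = \int[mu]_t (x t ^+ 2)%:E)%E.
Proof.
rewrite -Lnorm2_sqr Lspace_normE EFin_expe.
by rewrite -(@finite_norm_fine _ _ _ _ _ _ (Lspace_repr x)).
Qed.

End square_integrable.

(* Schur test for the Hilbert matrix with weights sqrt (i + 1). The constant 8
   is not sharp (pi is); it only serves to show that the moment operator below
   is well defined and bounded. *)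
Section hilbert_matrix.
Variable R : realType.

Let row (i n : nat) :
  \sum_(j < n) Num.sqrt i.+1%:R / (Num.sqrt j.+1%:R * (i + j).+1%:R) <=
  8 * Num.sqrt n%:R / (Num.sqrt n%:R + Num.sqrt i.+1%:R) :> R.
Proof.
set w := Num.sqrt i.+1%:R.
have w0 : 0 < w by rewrite sqrtr_gt0.
have w2 : w ^+ 2 = i%:R + 1 by rewrite sqr_sqrtr// -natr1.
elim: n => [|n ih]; first by rewrite big_ord0 sqrtr0 mulr0 mul0r.
rewrite big_ord_recr/=; move: ih; set S := \sum_(_ < n) _ => ih.
apply: (le_trans (lerD ih (lexx _))).
set a := Num.sqrt n%:R; set b := Num.sqrt n.+1%:R.
have a0 : 0 <= a by exact: sqrtr_ge0.
have b0 : 0 < b by rewrite sqrtr_gt0.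
have a2 : a ^+ 2 = n%:R by rewrite sqr_sqrtr.
have b2 : b ^+ 2 = n%:R + 1 by rewrite sqr_sqrtr// -natr1.
have ab : a <= b by rewrite ler_sqrt// ler_nat.
have i0 : 0 <= i%:R :> R by [].
have -> : (i + n).+1%:R = w ^+ 2 + a ^+ 2 :> R.
  by rewrite w2 a2 -natr1 natrD addrAC.
have aw : 0 < a + w by lra.
have bw : 0 < b + w by lra.
have k0 : 0 < w ^+ 2 + a ^+ 2 by nra.
rewrite -lerBrDl.
have ba : 0 < b + a by lra.
have h1 : b - a = (b + a)^-1.
  apply: (mulIf (lt0r_neq0 ba)); rewrite mulVf ?lt0r_neq0//; nra.
have -> : 8 * b / (b + w) - 8 * a / (a + w) = 8 * w * (b - a) / ((b + w) * (a + w)).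
  by field; rewrite !gt_eqF.
rewrite h1 -subr_ge0.
rewrite [X in 0 <= X](_ : _
  = w * (8 * (b * (w ^+ 2 + a ^+ 2)) - (b + a) * ((b + w) * (a + w))) /
    ((b + a) * ((b + w) * (a + w)) * (b * (w ^+ 2 + a ^+ 2)))); last first.
  by field; rewrite !gt_eqF.
apply: divr_ge0; last by rewrite ltW// !mulr_gt0.
apply: mulr_ge0; [exact: ltW | rewrite subr_ge0].
have e1 : (b + w) * (a + w) <= 4 * (w ^+ 2 + a ^+ 2).
  apply: (@le_trans _ _ ((b + w) * (b + w))).
    by apply: ler_wpM2l; [exact: ltW | rewrite lerD2r].
  have := sqr_ge0 (b - w); have := sqr_ge0 a; nra.
apply: (@le_trans _ _ ((b + a) * (4 * (w ^+ 2 + a ^+ 2)))).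
  by rewrite ler_wpM2l// ltW.
by rewrite [leRHS](_ : _ = (2 * b) * (4 * (w ^+ 2 + a ^+ 2))); [apply: ler_wpM2r; nra | ring].
Qed.

Lemma hilbert_ineq n (c : nat -> R) :
  \sum_(i < n) \sum_(j < n) c i * c j / (i + j).+1%:R <= 8 * \sum_(i < n) c i ^+ 2.
Proof.
pose w (i : nat) : R := Num.sqrt i.+1%:R.
have w0 i : 0 < w i by rewrite sqrtr_gt0.
pose F (i j : nat) : R := c i ^+ 2 * (w i / (w j * (i + j).+1%:R)).
have h1 (i j : nat) : c i * c j / (i + j).+1%:R <= (F i j + F j i) / 2.
  rewrite /F [(j + i)%N]addnC.
  have k0 : 0 < (i + j).+1%:R :> R by rewrite ltr0n.
  set k := (i + j).+1%:R in k0 *.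
  have wi := w0 i; have wj := w0 j.
  rewrite -subr_ge0.
  have -> : (c i ^+ 2 * (w i / (w j * k)) + c j ^+ 2 * (w j / (w i * k))) / 2 - c i * c j / k
    = (c i * w i - c j * w j) ^+ 2 / (2 * (w i * w j * k)).
    by field; rewrite !gt_eqF.
  by rewrite divr_ge0 ?sqr_ge0// ltW// !mulr_gt0.
apply: (@le_trans _ _ (\sum_(i < n) \sum_(j < n) (F i j + F j i) / 2)).
  by apply: ler_sum => i _; apply: ler_sum => j _; exact: h1.
have -> : \sum_(i < n) \sum_(j < n) (F i j + F j i) / 2 = \sum_(i < n) \sum_(j < n) F i j.
  under eq_bigr do rewrite -mulr_suml big_split/=.
  rewrite -mulr_suml big_split/= [X in _ + X]exchange_big/=.
  by field.
rewrite mulr_sumr; apply: ler_sum => i _.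
rewrite -mulr_sumr mulrC ler_wpM2r ?sqr_ge0//.
apply: (le_trans (row i n)); rewrite ler_pdivrMr; last by rewrite ltr_wpDl ?sqrtr_ge0 ?sqrtr_gt0.
by rewrite ler_wpM2l// lerDl sqrtr_ge0.
Qed.
End hilbert_matrix.

Section unit_interval.
Variable R : realType.
Local Notation mu := (@lebesgue_measure R).
Local Notation D := (`]0%R, 1%R[%classic : set R).

Definition lebesgue01 : {measure set (measurableTypeR R) -> \bar R} :=
  mrestr mu (measurable_itv `]0%R, 1%R[).

Lemma integral_lebesgue01 (f : measurableTypeR R -> \bar R) : measurable_fun setT f ->
  (\int[lebesgue01]_t f t = \int[mu]_(t in D) f t)%E.
Proof.
move=> mf; have mD : measurable D by exact: measurable_itv.
rewrite -(setUv D) integral_setU//; last 3 first.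
- exact: measurableC.
- by rewrite setUv.
- exact/disj_setPCl.
rewrite [X in (_ + X)%E]null_set_integral ?adde0//.
- apply: eq_measure_integral => A mA AD.
  by rewrite /lebesgue01/= /mrestr setIidl.
- exact: measurableC.
- exact: measurable_funTS.
- by rewrite /lebesgue01/= /mrestr setICl measure0.
Qed.

Lemma ae_lebesgue01 (P : measurableTypeR R -> Prop) :
  (\forall t \ae lebesgue01, P t) -> \forall t \ae mu, D t -> P t.
Proof.
move=> [A [mA A0 PA]]; exists (A `&` D); split => //.
  by apply: measurableI => //; exact: measurable_itv.
move=> t /= /not_implyP[Dt nPt]; split => //; exact: PA.
Qed.

Lemma integrable_lebesgue01 (f : measurableTypeR R -> R) : measurable_fun setT f ->
  lebesgue01.-integrable setT (EFin \o f) -> mu.-integrable D (EFin \o f).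
Proof.
move=> mf /integrableP[mEf fi]; apply/integrableP; split.
  exact: measurable_funTS.
by rewrite -integral_lebesgue01//; exact: measurableT_comp.
Qed.

Let mD : measurable (D : set (measurableTypeR R)). Proof. exact: measurable_itv. Qed.

Let exprn01 j (t : R) : D t -> `|t ^+ j| <= 1.
Proof.
rewrite /= in_itv/= => /andP[t0 t1].
by rewrite ger0_norm ?exprn_ge0 ?exprn_ile1// ltW.
Qed.

Lemma integrable_monoM j (h : R -> R) : mu.-integrable D (EFin \o h) ->
  mu.-integrable D (EFin \o (fun t => t ^+ j * h t)).
Proof.
move=> ih.
apply: (@integrableMr _ _ _ mu D mD (fun t => t ^+ j) (EFin \o h) _ _ ih).
  exact: measurable_funTS.
exists 1; split => // M M1 t Dt /=.
exact: le_trans (exprn01 j Dt) (ltW M1).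
Qed.

Let integrableZ (a : R) (h : R -> R) : mu.-integrable D (EFin \o h) ->
  mu.-integrable D (EFin \o (fun t => a * h t)).
Proof.
move=> ih; have := integrableZl mD a ih; by congr (integrable _ _ _).
Qed.

Let integrableD' (g h : R -> R) : mu.-integrable D (EFin \o g) ->
  mu.-integrable D (EFin \o h) ->
  mu.-integrable D (EFin \o (fun t => g t + h t)).
Proof.
move=> ig ih; have := integrableD mD ig ih.
by congr (integrable _ _ _).
Qed.

Lemma integral_poly01 n (c : nat -> R) (h : R -> R) : mu.-integrable D (EFin \o h) ->
  mu.-integrable D (EFin \o (fun t => (\sum_(j < n) c j * t ^+ j) * h t)) /\
  \int[mu]_(t in D) ((\sum_(j < n) c j * t ^+ j) * h t) =
  \sum_(j < n) c j * \int[mu]_(t in D) (t ^+ j * h t).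
Proof.
move=> ih; elim: n => [|n [ihn eqn]].
  rewrite big_ord0; split.
    under [X in EFin \o X]eq_fun do rewrite big_ord0 mul0r.
    exact: integrable0.
  by under eq_Rintegral do rewrite big_ord0 mul0r; rewrite /Rintegral integral0.
have inj := integrable_monoM n ih.
have inc : mu.-integrable D (EFin \o (fun t => c n * (t ^+ n * h t))).
  exact: (integrableZ (c n) inj).
split.
  under [X in EFin \o X]eq_fun do rewrite big_ord_recr/= mulrDl -[_ * _ * h _]mulrA.
  exact: (integrableD' ihn inc).
under eq_Rintegral do rewrite big_ord_recr/= mulrDl -[_ * _ * h _]mulrA.
by rewrite RintegralD// RintegralZl// eqn big_ord_recr.
Qed.

Let integrable_one01 : mu.-integrable D (EFin \o (fun=> 1 : R)).
Proof.
apply: measurable_bounded_integrable => //.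
  by rewrite /= lebesgue_measure_itv/= lte_fin ltr01 EFinN sube0 ltry.
by exists 1; split => // M M1 t _ /=; rewrite normr1 ltW.
Qed.

Lemma integral_mono01 k : \int[mu]_(t in D) t ^+ k = k.+1%:R^-1 :> R.
Proof.
pose F (t : R) : R := k.+1%:R^-1 * t ^+ k.+1.
have dF (t : R) : is_derive t 1 F (t ^+ k).
  have h : is_derive t 1 (fun y : R => y ^+ k.+1) (k.+1%:R * t ^+ k).
    apply: DeriveDef; first exact: exprn_derivable.
    by rewrite exp_derive /= [LHS]mulr1.
  have := is_deriveZ k.+1%:R^-1 h.
  by rewrite [X in is_derive _ _ _ X -> _](_ : _ = t ^+ k)//= [LHS]mulrA mulVf// mul1r.
have cF : {in `]0, 1[, F^`()%classic =1 (fun t => t ^+ k)}.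
  by move=> t _; rewrite derive1E; exact: derive_val.
have ck : {within `[0, 1], continuous (fun t : R => t ^+ k)}.
  by apply: continuous_subspaceT => t; exact: exprn_continuous.
have oF : derivable_oo_LRcontinuous F 0 1.
  split.
  - by move=> t _; exact: ex_derive.
  - apply: cvg_at_right_filter; apply: differentiable_continuous; apply/derivable1_diffP; exact: ex_derive.
  - apply: cvg_at_left_filter; apply: differentiable_continuous; apply/derivable1_diffP; exact: ex_derive.
have := continuous_FTC2 ltr01 ck oF cF.
rewrite integral_itv_bndoo; last first.
  by apply: measurable_funTS; apply/measurable_EFinP; exact: measurable_funX.
rewrite /Rintegral => ->/=.
by rewrite /F expr1n mulr1 expr0n mulr0 subr0.
Qed.

Lemma moment_bessel n (x : R -> R) : mu.-integrable D (EFin \o x) ->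
  mu.-integrable D (EFin \o (fun t => x t ^+ 2)) ->
  \sum_(j < n) (\int[mu]_(t in D) (t ^+ j * x t)) ^+ 2 <= 8 * \int[mu]_(t in D) (x t ^+ 2).
Proof.
move=> ix ix2.
pose c j := \int[mu]_(t in D) (t ^+ j * x t).
pose P (t : R) : R := \sum_(j < n) c j * t ^+ j.
set S := \sum_(j < n) _.
have i1 : mu.-integrable D (EFin \o (fun=> 1 : R)).
  exact: integrable_one01.
have [iP1 _] := integral_poly01 n c i1.
have iP : mu.-integrable D (EFin \o P).
  by move: iP1; under [X in EFin \o X]eq_fun do rewrite mulr1.
have [iPx Px] := integral_poly01 n c ix.
have [iPP PP] := integral_poly01 n c iP.
have mono2 i j : \int[mu]_(t in D) (t ^+ i * t ^+ j) = (i + j).+1%:R^-1.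
  by under eq_Rintegral do rewrite -exprD; exact: integral_mono01.
have PP8 : \int[mu]_(t in D) (P t * P t) <= 8 * S.
  rewrite PP; apply: le_trans (hilbert_ineq n c).
  apply: ler_sum => i _; under eq_Rintegral do rewrite mulrC.
  have im : mu.-integrable D (EFin \o (fun t : R => t ^+ i)).
    by have := integrable_monoM i i1; under [X in EFin \o X]eq_fun do rewrite mulr1.
  rewrite (integral_poly01 n c im).2 mulr_sumr; apply: ler_sum => j _.
  by rewrite mono2 addnC mulrA.
have : 0 <= \int[mu]_(t in D) (P t - 8 * x t) ^+ 2.
  by apply: Rintegral_ge0 => t _; exact: sqr_ge0.
have -> : \int[mu]_(t in D) (P t - 8 * x t) ^+ 2 =
   \int[mu]_(t in D) (P t * P t) - 16 * S + 64 * \int[mu]_(t in D) x t ^+ 2.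
  under eq_Rintegral => t _.
    rewrite (_ : _ ^+ 2 = P t * P t + ((-16) * (P t * x t) + 64 * x t ^+ 2)); last by ring.
    over.
  have i16 : mu.-integrable D (EFin \o (fun t => (-16) * (P t * x t))).
    exact: (integrableZ (-16) iPx).
  have i64 : mu.-integrable D (EFin \o (fun t => 64 * x t ^+ 2)).
    exact: (integrableZ 64 ix2).
  rewrite RintegralD//; last exact: (integrableD' i16 i64).
  rewrite RintegralD// !RintegralZl// Px.
  have -> : \sum_(j < n) c j * \int[mu]_(t in D) (t ^+ j * x t) = S by [].
  by ring.
lra.
Qed.
End unit_interval.

(* Under the counting measure a.e. equality is pointwise equality (ell2P), so
   y j is the genuine j-th coordinate of y : ell2 R. *)
Notation L2_01 R := (LspaceType (lebesgue01 R) (lee1n 2)).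
Notation ell2 R := (LspaceType (@counting nat R) (lee1n 2)).

Section ell2.
Variable R : realType.

Lemma ae_counting (P : nat -> Prop) :
  (\forall n \ae (@counting nat R), P n) <-> forall n, P n.
Proof.
split=> [[A [_ A0 PA]] n|h]; last exact: aeW.
apply: contrapT => nPn; have /PA An : (~` P) n by [].
move: A0; rewrite /counting; case: asboolP => // fA [] /eqP.
rewrite pnatr_eq0 finmap.cardfs_eq0 => /eqP A0.
by move: An; rewrite -(fset_setK fA) A0 set_fset0.
Qed.

Lemma ell2P (x y : ell2 R) : x =1 y <-> x = y.
Proof.
split=> [xy|->//]; apply/LspaceP/ae_counting => n _; exact: xy.
Qed.

Lemma ell2D (x y : ell2 R) n : (x + y) n = x n + y n.
Proof. by have /ae_counting /(_ n) -> := Lspace_addE x y. Qed.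

Lemma ell2Z a (x : ell2 R) n : (a *: x) n = a * x n.
Proof. by have /ae_counting /(_ n) -> := Lspace_scaleE a x. Qed.

Lemma ell2_norm_sqr (y : ell2 R) : ((`|y| ^+ 2)%:E = \sum_(j <oo) (y j ^+ 2)%:E)%E.
Proof.
rewrite Lspace2_norm_sqr ge0_integral_count// => k.
by rewrite lee_fin sqr_ge0.
Qed.

Lemma square_summable_in_Lfun (u : nat -> R) (C : R) :
  (forall n, \sum_(j < n) u j ^+ 2 <= C) ->
  (u \in Lfun (@counting nat R) 2%:E) /\ (\sum_(j <oo) (u j ^+ 2)%:E <= C%:E)%E.
Proof.
move=> uC.
have sC : (\sum_(j <oo) (u j ^+ 2)%:E <= C%:E)%E.
  apply: lime_le; first by apply: is_cvg_nneseries => n _ _; rewrite lee_fin sqr_ge0.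
  by apply: nearW => n; rewrite sumEFin big_mkord lee_fin.
split=> //; rewrite inE; apply/andP; split; rewrite inE//=.
rewrite /finite_norm.
have : ('N[counting]_2[EFin \o u] ^+ 2 < +oo)%E.
  rewrite Lnorm2_sqr ge0_integral_count; last by move=> k; rewrite lee_fin sqr_ge0.
  by rewrite (le_lt_trans sC)// ltry.
move: (Lnorm_ge0 (@counting nat R) 2%:E (EFin \o u)).
case: ('N[_]_2[_])%E => [r||] // _ _; exact: ltry.
Qed.

End ell2.

Section moment_operator.
Variable R : realType.
Local Notation mu := (@lebesgue_measure R).
Local Notation D := (`]0%R, 1%R[%classic : set R).
Implicit Types x : L2_01 R.

Definition moment x (j : nat) : R := \int[mu]_(t in D) (t ^+ j * x t).

Let integrable_sqr x : mu.-integrable D (EFin \o (fun t => x t ^+ 2)).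
Proof.
apply: integrable_lebesgue01; last first.
  exact: (Lfun2_integrable_sqr (Lspace_in_Lfun x)).
by apply: measurable_funX; exact: measurable_Lspace.
Qed.

Let integrable_L2_01 x : mu.-integrable D (EFin \o (x : R -> R)).
Proof.
apply: integrable_lebesgue01; first exact: measurable_Lspace.
apply/Lfun1_integrable; apply: Lfun_subset12; last exact: Lspace_in_Lfun.
by rewrite /lebesgue01/= /mrestr setTI /= lebesgue_measure_itv/= lte_fin ltr01 EFinN sube0.
Qed.

Lemma Rintegral_sqr_L2_01 x : \int[mu]_(t in D) (x t ^+ 2) = `|x| ^+ 2.
Proof.
apply: EFin_inj; rewrite Lspace2_norm_sqr integral_lebesgue01; last first.
  by apply/measurable_EFinP; apply: measurable_funX; exact: measurable_Lspace.
by rewrite /Rintegral fineK//; apply: integrable_fin_num => //; exact: integrable_sqr.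
Qed.

Let moment_sqr x n : \sum_(j < n) moment x j ^+ 2 <= 8 * `|x| ^+ 2.
Proof. by rewrite -Rintegral_sqr_L2_01; exact: moment_bessel. Qed.

(* Coordinates are numbered from 0: coordinate j of the image is the moment
   against t ^+ j, see moment_operatorE. *)
Definition moment_operator x : ell2 R :=
  Lspace_class (Lfun_Sub (lee1n 2) (square_summable_in_Lfun (moment_sqr x)).1).

Lemma moment_operatorE x j :
  moment_operator x j = \int[mu]_(t in D) (t ^+ j * x t).
Proof.
by have /ae_counting /(_ j) -> := Lspace_classE
  (Lfun_Sub (lee1n 2) (square_summable_in_Lfun (moment_sqr x)).1).
Qed.

Lemma moment_operator_linear : linear moment_operator.
Proof.
move=> a x y; apply/ell2P => j.
rewrite ell2D ell2Z !moment_operatorE.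
have ix := integrable_monoM j (integrable_L2_01 x).
have iy := integrable_monoM j (integrable_L2_01 y).
have mD : measurable (D : set (measurableTypeR R)) by exact: measurable_itv.
have iax : mu.-integrable D (EFin \o (fun t => a * (t ^+ j * x t))).
  by have := integrableZl mD a ix; congr (integrable _ _ _).
rewrite -RintegralZl// -RintegralD//; congr fine.
apply: ae_eq_integral => //.
- apply/measurable_EFinP; apply: measurable_funM.
    exact: measurable_funTS.
  by apply: measurable_funTS; exact: measurable_Lspace.
- apply/measurable_EFinP; apply: measurable_funD; apply/measurable_EFinP.
    by case/integrableP : iax.
  by case/integrableP : iy.
- have e1 := Lspace_addE (a *: x) y; have e2 := Lspace_scaleE a x.
  apply: ae_lebesgue01; apply: filterS2 e1 e2 => t h1 h2.
  by rewrite h1// h2// mulrDr mulrCA.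
Qed.

HB.instance Definition _ := GRing.isLinear.Build R (L2_01 R) (ell2 R) _
  moment_operator moment_operator_linear.

Lemma moment_operator_sqr_norm x : `|moment_operator x| ^+ 2 <= 8 * `|x| ^+ 2.
Proof.
rewrite -lee_fin ell2_norm_sqr.
under eq_eseriesr do rewrite moment_operatorE.
exact: (square_summable_in_Lfun (moment_sqr x)).2.
Qed.

Lemma moment_operator_continuous : continuous moment_operator.
Proof.
apply: bounded_linear_continuous; apply/linear_boundedP.
exists 3; split => // M M3 x.
have M0 : 0 <= M by rewrite (le_trans _ (ltW M3)).
rewrite -ler_sqr ?nnegrE ?mulr_ge0// exprMn.
apply: (le_trans (moment_operator_sqr_norm x)).
by rewrite ler_wpM2r ?sqr_ge0//; nra.
Qed.
End moment_operator.

(* Nashed's notions; they are meant for bounded A between Hilbert spaces, but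
   only refer to the topology and the linear structure of Y. *)
Section nashed.
Variables (R : realType) (X Y : normedModType R).

Definition finite_dimensional (V : set Y) : Prop :=
  exists (n : nat) (v : 'I_n -> Y),
    V = range (fun c : 'I_n -> R => \sum_(i < n) c i *: v i).

Definition ill_posed (A : {linear X -> Y}) : Prop := ~ closed (range A).

Definition ill_posed_type_I (A : {linear X -> Y}) : Prop :=
  ill_posed A /\
  exists V : set Y, [/\ submod_closed [in V], closed V,
    ~ finite_dimensional V & V `<=` range A].
End nashed.

(* Main.v *)
(* Put f_n = n 1_(0,1/n). Then A f_n tends to e_0 = (1, 0, 0, ...), while
   A x = e_0 would give [\int (1 - t)^n x = 1] for all n, against dominated
   convergence. So the range is not closed.
   For the infinite-dimensional closed subspace, take x_k = 1_{I_k} / p_k with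
   p_k = 128^-k / 2 and I_k = (1 - 2 p_k^2, 1 - p_k^2). The x_k are orthonormal
   and concentrate at t = 1, where the moments (A x_k)_j stay of order p_k up to
   j ~ p_k^-2. Hence |A x_k|^2 >= 1/16, whereas <A x_k, A x_l> <= 128^-|k - l|:
   the A x_k are almost orthogonal, A is bounded below on the closed span of the
   x_k, and the image of that span is closed. *)
From HB Require Import structures.
Require Import Defs.
From mathcomp Require Import all_boot all_order all_algebra.
From mathcomp Require Import all_classical all_reals all_analysis.
From mathcomp Require Import measurable_realfun.
From mathcomp Require Import ring lra.

Set Implicit Arguments.
Unset Strict Implicit.
Unset Printing Implicit Defensive.
Import Order.TTheory GRing.Theory Num.Theory numFieldNormedType.Exports.
Local Open Scope classical_set_scope.
Local Open Scope ring_scope.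

(** * Elementary inequalities and a lower bound for almost orthogonal families *)

Section almost_orthogonality.
Variable R : realType.
Implicit Types (c : nat -> R) (q t u : R).

Lemma geom_sum_le t n : 0 <= t < 1 -> \sum_(j < n) t ^+ j <= (1 - t)^-1.
Proof.
move=> /andP[t0 t1]; rewrite -[leRHS]mul1r ler_pdivlMr ?subr_gt0//.
by rewrite mulrC -opprB mulNr -subrX1 opprB lerBlDr lerDl exprn_ge0.
Qed.

Lemma bernoulli_le u n : 0 <= u <= 1 -> 1 - n%:R * u <= (1 - u) ^+ n.
Proof.
move=> /andP[u0 u1]; elim: n => [|n ih]; first by rewrite mul0r subr0 expr0.
rewrite exprS; apply: le_trans _ (ler_wpM2l _ ih); last by rewrite subr_ge0.
by rewrite -natr1; have : 0 <= n%:R :> R by []; nra.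
Qed.

Lemma sqr_sum (z : nat -> R) n : (\sum_(k < n) z k) ^+ 2 =
  \sum_(k < n) z k ^+ 2 + 2 * \sum_(k < n) \sum_(l < k) z k * z l.
Proof.
elim: n => [|n ih]; first by rewrite !big_ord0; ring.
by rewrite !big_ord_recr/= sqrrD ih -mulr_sumr; ring.
Qed.

Lemma offdiag_le q c n : 0 < q <= 2^-1 ->
  \sum_(k < n) \sum_(l < k) `|c k| * `|c l| * q ^+ (k - l) <=
  5 / 2 * q * \sum_(k < n) c k ^+ 2.
Proof.
move=> /andP[q0 q1].
(* [q^-1 * s n ^+ 2] is a potential that absorbs the cross terms of each step. *)
pose s k := \sum_(l < k) `|c l| * q ^+ (k - l).
have sS k : s k.+1 = q * (s k + `|c k|).
  rewrite /s big_ord_recr/= subSnn mulrDr mulr_sumr; congr (_ + _); last by rewrite mulrC.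
  by apply: eq_bigr => l _; rewrite subSn ?(ltnW (ltn_ord l))// exprS mulrCA.
suff : \sum_(k < n) `|c k| * s k + q^-1 * s n ^+ 2 <= 5 / 2 * q * \sum_(k < n) c k ^+ 2.
  move=> h; apply: le_trans _ h; rewrite -[leLHS]addr0; apply: lerD; last first.
    by rewrite mulr_ge0 ?sqr_ge0// invr_ge0 ltW.
  by apply: ler_sum => k _; rewrite mulr_sumr; apply: ler_sum => l _; rewrite mulrA.
elim: n => [|n ih]; first by rewrite !big_ord0 /s big_ord0 expr0n !mulr0 addr0.
rewrite !big_ord_recr/= sS [leRHS]mulrDr -[c n ^+ 2]real_normK ?num_real//.
apply: le_trans _ (lerD ih (lexx _)); rewrite -!addrA lerD2l.
set x := `|c n|; set y := s n.
have -> : q^-1 * (q * (y + x)) ^+ 2 = q * (y + x) ^+ 2 by field; rewrite gt_eqF.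
have -> : y = q * (y / q) by field; rewrite gt_eqF.
set w := y / q.
have -> : q^-1 * (q * w) ^+ 2 = q * w ^+ 2 by field; rewrite gt_eqF.
have -> : x * (q * w) + q * (q * w + x) ^+ 2 =
  q * (x * w + (q * w + x) ^+ 2) by ring.
rewrite [leRHS](_ : _ = q * (w ^+ 2 + 5 / 2 * x ^+ 2)); last by ring.
apply: ler_wpM2l; first exact: ltW.
have h : q ^+ 2 * w ^+ 2 <= 4^-1 * w ^+ 2.
  apply: ler_wpM2r; first exact: sqr_ge0.
  have : 0 <= (2^-1 - q) * (2^-1 + q) by apply: mulr_ge0; lra.
  by rewrite expr2; lra.
(* Young's inequality on [x * w] and on [2 * q * w * x], with [h] counted twice, adds up to exactly
   [w ^+ 2 + 5 / 2 * x ^+ 2]; this fixes the constant 5/2. *)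
have := sqr_ge0 (x - w); have := sqr_ge0 (q * w - x); nra.
Qed.

(** After expanding the squares, the diagonal of the Gram matrix contributes at least [d], while by
    [offdiag_le] the two off-diagonal triangles cost at most [2 * (5 / 2) * q]. *)
Lemma almost_orthogonal_le q (d : R) (a : nat -> nat -> R) c n m : 0 < q <= 2^-1 ->
  (forall k, (k < n)%N -> d <= \sum_(j < m) a k j ^+ 2) ->
  (forall k l, (l < k < n)%N -> `|\sum_(j < m) a k j * a l j| <= q ^+ (k - l)) ->
  (d - 5 * q) * \sum_(k < n) c k ^+ 2 <= \sum_(j < m) (\sum_(k < n) c k * a k j) ^+ 2.
Proof.
move=> q01 da qa.
under [leRHS]eq_bigr do rewrite (sqr_sum (fun k => c k * a k _)).
rewrite big_split/= mulrBl; apply: lerD.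
  rewrite exchange_big/= mulr_sumr; apply: ler_sum => k _.
  under eq_bigr do rewrite exprMn.
  by rewrite -mulr_sumr mulrC ler_wpM2l ?sqr_ge0// da.
rewrite -mulr_sumr exchange_big/= lerNl.
under eq_bigr do rewrite exchange_big/=.
apply: (@le_trans _ _ (2 * (5 / 2 * q * \sum_(k < n) c k ^+ 2))); last lra.
apply: le_trans _ (ler_wpM2l _ (offdiag_le c n q01)) => //.
rewrite -mulrN ler_wpM2l// -sumrN; apply: ler_sum => k _.
rewrite -sumrN; apply: ler_sum => l _.
under eq_bigr do rewrite mulrACA.
rewrite -mulr_sumr; apply: le_trans (ler_norm _) _.
by rewrite normrN !normrM ler_wpM2l ?mulr_ge0// qa// ltn_ord/=.
Qed.

End almost_orthogonality.

(** * Square integrable functions and their classes *)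

Section square_integrable_classes.
Context d (T : measurableType d) (R : realType).
Variable mu : {measure set T -> \bar R}.

Lemma sqr_integral_Lfun (f : T -> R) : measurable_fun [set: T] f ->
  (\int[mu]_t (f t ^+ 2)%:E < +oo)%E -> f \in Lfun mu 2%:E.
Proof.
move=> mf f2; rewrite inE; apply/andP; split; rewrite inE//=.
rewrite /finite_norm; move: f2; rewrite -Lnorm2_sqr.
by move: (Lnorm_ge0 mu 2%:E (EFin \o f)); case: ('N[_]_2[_])%E => [r||] // _ _; exact: ltry.
Qed.

Lemma Lspace2_class_norm_sqr (f : LfunType mu (lee1n 2)) :
  ((`|Lspace_class f| ^+ 2)%:E = \int[mu]_t (f t ^+ 2)%:E)%E.
Proof.
rewrite Lspace2_norm_sqr; apply: ae_eq_integral => //.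
- by apply/measurable_EFinP; apply: measurable_funX; exact: measurable_Lspace.
- by apply/measurable_EFinP; apply: measurable_funX; exact: measurable_funPT.
- by have e := Lspace_classE f; apply: filterS e => t /= h _; rewrite h.
Qed.

End square_integrable_classes.

(** * Coordinates, unit vectors and truncations in the sequence space *)

Section ell2_extra.
Variable R : realType.
Implicit Types y : ell2 R.

(** Together with [sum_sqr_le_ell2_norm], this reduces norm estimates to finite sums of coordinates,
    uniformly in their length. *)
Lemma ell2_norm_sqr_le y (C : R) :
  (forall n, \sum_(j < n) y j ^+ 2 <= C) -> `|y| ^+ 2 <= C.
Proof.
by move=> yC; rewrite -lee_fin ell2_norm_sqr; exact: (square_summable_in_Lfun yC).2.
Qed.

Lemma sum_sqr_le_ell2_norm y n : \sum_(j < n) y j ^+ 2 <= `|y| ^+ 2.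
Proof.
rewrite -lee_fin ell2_norm_sqr -sumEFin -(big_mkord xpredT (fun j => (y j ^+ 2)%:E)).
by apply: nneseries_lim_ge => k _ _; rewrite lee_fin sqr_ge0.
Qed.

Lemma ell2_0 n : (0 : ell2 R) n = 0.
Proof. by rewrite -(scale0r 0) ell2Z mul0r. Qed.

Lemma ell2N y n : (- y) n = - y n.
Proof. by rewrite -scaleN1r ell2Z mulN1r. Qed.

Lemma ell2B y z n : (y - z) n = y n - z n.
Proof. by rewrite ell2D ell2N. Qed.

Lemma ell2_sum (I : Type) (r : seq I) (P : pred I) (u : I -> ell2 R) n :
  (\sum_(i <- r | P i) u i) n = \sum_(i <- r | P i) u i n.
Proof.
elim/big_rec2: _ => [|i x y _ <-]; [exact: ell2_0 | exact: ell2D].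
Qed.

Lemma ell2_class (u : nat -> R) (uL : u \in Lfun (@counting nat R) 2%:E) j :
  Lspace_class (Lfun_Sub (lee1n 2) uL) j = u j.
Proof. by have /ae_counting -> := Lspace_classE (Lfun_Sub (lee1n 2) uL). Qed.

Lemma delta_square_summable k n : \sum_(j < n) ((j == k :> nat)%:R : R) ^+ 2 <= 1.
Proof.
case: (ltnP k n) => kn.
  rewrite (bigD1 (Ordinal kn))//= eqxx expr1n big1 ?addr0// => j.
  by rewrite -val_eqE/= => /negbTE ->; rewrite expr0n.
rewrite big1 ?ler01// => j _.
by rewrite ltn_eqF ?expr0n// (leq_trans (ltn_ord j)).
Qed.

Definition ell2_delta (k : nat) : ell2 R :=
  Lspace_class (Lfun_Sub (lee1n 2) 
    (@square_summable_in_Lfun R (fun j => (j == k)%:R) 1 (delta_square_summable k)).1).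

Lemma ell2_deltaE k j : ell2_delta k j = (j == k)%:R.
Proof. exact: ell2_class. Qed.

Lemma sum_ell2_delta n (c : nat -> R) j :
  (\sum_(k < n) c k *: ell2_delta k) j = if (j < n)%N then c j else 0.
Proof.
rewrite ell2_sum; under eq_bigr do rewrite ell2Z ell2_deltaE.
case: ifPn => [jn|].
  rewrite (bigD1 (Ordinal jn))//= eqxx mulr1 big1 ?addr0// => k.
  by rewrite -val_eqE/= eq_sym => /negbTE ->; rewrite mulr0.
rewrite -leqNgt => nj; rewrite big1// => k _.
by rewrite gtn_eqF ?mulr0// (leq_trans (ltn_ord k)).
Qed.

(** The squared distance from a truncation to [c] is a tail of the convergent series of squares. *)
Lemma ell2_truncation_cvg (c : ell2 R) :
  (\sum_(k < n) c k *: ell2_delta k) @[n --> \oo] --> c.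
Proof.
have c0 k : (0 <= (c k ^+ 2)%:E)%E by rewrite lee_fin sqr_ge0.
have tail n : ((`|\sum_(k < n) c k *: ell2_delta k - c| ^+ 2)%:E =
    \sum_(n <= k <oo) (c k ^+ 2)%:E)%E.
  rewrite ell2_norm_sqr (nneseries_split 0 n); last by move=> k _; rewrite lee_fin sqr_ge0.
  rewrite add0n big_nat big1 ?add0e => [|k /= kn]; last first.
    by rewrite ell2B sum_ell2_delta kn subrr expr0n.
  rewrite eseries_cond [RHS]eseries_cond; apply: eq_eseriesr => k.
  by rewrite ell2B sum_ell2_delta /= ltnNge => -> /=; rewrite sub0r sqrrN.
have : (\sum_(n <= k <oo) (c k ^+ 2)%:E)%E @[n --> \oo] --> 0%E.
  by apply: nneseries_tail_cvg => //; rewrite -ell2_norm_sqr ltry.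
under eq_fun do rewrite -tail.
move=> /fine_cvgP[_ /= h]; apply/subr_cvg0/norm_cvg0P.
rewrite -(sqrtr0 R); under eq_fun do rewrite -(normr_id (_ - _)) -sqrtr_sqr.
by apply: continuous_cvg => //; exact: sqrt_continuous.
Qed.

End ell2_extra.

(** * Completeness of the sequence space and closed ranges *)

Section ell2_complete.
Variable R : realType.

Lemma ell2_complete (u : nat -> ell2 R) :
  (forall e : R, 0 < e -> exists N, forall n m, (N <= n)%N -> (N <= m)%N -> `|u n - u m| <= e) ->
  exists c : ell2 R, u @ \oo --> c.
Proof.
move=> u_cauchy.
have coord_cvg k : cvgn (fun n => u n k).
  apply: (@cauchy_cvg R^o); apply: cauchy_exP => e e0.
  have [N uN] := u_cauchy (e / 2) (divr_gt0 e0 (ltr0Sn _ _)).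
  exists (u N k); exists N => //= n Nn; rewrite /ball/= -ell2B.
  have : `|(u N - u n) k| <= `|u N - u n|.
    rewrite -ler_sqr ?nnegrE// real_normK ?num_real//.
    apply: le_trans (sum_sqr_le_ell2_norm _ k.+1).
    by rewrite big_ord_recr/= lerDr sumr_ge0// => j _; exact: sqr_ge0.
  by have := uN N n (leqnn N) Nn; lra.
pose l k : R := limn (fun n => u n k).
(* With [J] fixed the sum is finite, so the Cauchy bound on [u n - u m] passes to the limit in [m];
   uniformity in [J] then turns coordinatewise convergence into norm convergence. *)
have dist_l (e : R) : 0 < e -> exists N, forall n, (N <= n)%N ->
    forall J, \sum_(k < J) (u n k - l k) ^+ 2 <= e ^+ 2.
  move=> e0; have [N uN] := u_cauchy e e0; exists N => n Nn J.
  have h : (\sum_(k < J) (u n k - u m k) ^+ 2) @[m --> \oo] -->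
      \sum_(k < J) (u n k - l k) ^+ 2.
    apply: cvg_big => [|k _]; first exact: add_continuous.
    have h1 : (u n k - u m k) @[m --> \oo] --> u n k - l k.
      by apply: cvgB; [exact: cvg_cst | exact: coord_cvg].
    exact: (cvgM h1 h1).
  rewrite -(cvg_lim _ h)//; apply: limr_le; first by apply/cvg_ex; eexists; exact: h.
  near=> m; under eq_bigr do rewrite -ell2B.
  apply: le_trans (sum_sqr_le_ell2_norm _ _) _.
  rewrite ler_sqr ?nnegrE ?(ltW e0)//; apply: uN => //.
  by near: m; exact: nbhs_infty_ge.
have [N1 l1] := dist_l 1 ltr01.
have l_sqr J : \sum_(k < J) l k ^+ 2 <= 2 * (1 + `|u N1| ^+ 2).
  (* Termwise, the right side minus [l k ^+ 2] is the square of [2 * u N1 k - l k]. *)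
  apply: le_trans (_ : \sum_(k < J) 2 * ((u N1 k - l k) ^+ 2 + u N1 k ^+ 2) <= _).
    apply: ler_sum => k _; have := sqr_ge0 (u N1 k - l k + u N1 k).
    by have := sqr_ge0 (2 * u N1 k - l k); nra.
  rewrite -mulr_sumr big_split/= ler_wpM2l// lerD ?sum_sqr_le_ell2_norm//.
  by rewrite -[leRHS](expr1n _ 2) l1.
pose c : ell2 R := Lspace_class (Lfun_Sub (lee1n 2) (square_summable_in_Lfun l_sqr).1).
exists c; apply/cvgrPdist_le => e e0.
have [N lN] := dist_l e e0; exists N => //= n Nn.
rewrite distrC -ler_sqr ?nnegrE ?(ltW e0)//.
apply: ell2_norm_sqr_le => J.
by under eq_bigr do rewrite ell2B ell2_class; exact: lN.
Unshelve. all: by end_near. Qed.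

(** The lower bound makes preimages of approximants of a closure point a Cauchy sequence; by
    completeness they converge, and by continuity the limit is mapped to that point. *)
Lemma closed_range_ell2 (Y : normedModType R) (f : {linear ell2 R -> Y}) (K : R) :
  continuous f -> (forall c, `|c| <= K * `|f c|) -> closed (range f).
Proof.
move=> cf fK y ycl.
(* [K] may fail to be positive, so it is replaced by its absolute value plus 1, by which one can
   divide. *)
have K0 : 0 < `|K| + 1 by rewrite ltr_wpDl.
have fK' c : `|c| <= (`|K| + 1) * `|f c|.
  by apply: le_trans (fK c) _; rewrite ler_wpM2r// (le_trans (ler_norm K))// lerDl.
have : forall n, exists c, `|y - f c| < n.+1%:R^-1.
  move=> n; have : nbhs y (ball y (n.+1%:R^-1 : R)) by apply: nbhsx_ballx; rewrite invr_gt0.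
  by move=> /ycl[_ [[c _ <-]]]; rewrite -ball_normE; exists c.
move=> /choice[u yu].
have inv_cvg : (n.+1%:R^-1 : R) @[n --> \oo] --> (0 : R) by exact: cvg_harmonic.
have fu : (f \o u) @ \oo --> y.
  apply/cvgrPdist_lt => e e0; have /cvgrPdist_lt /(_ e e0) := inv_cvg.
  apply: filterS => n /=; rewrite sub0r normrN ger0_norm ?invr_ge0//.
  exact: lt_trans.
have [c uc] : exists c : ell2 R, u @ \oo --> c.
  apply: ell2_complete => e e0.
  have /cvgrPdist_lt /(_ (e / (2 * (`|K| + 1)))) := fu.
  rewrite divr_gt0 ?mulr_gt0// => /(_ isT)[N _ hN].
  exists N => n m Nn Nm; apply: le_trans (fK' _) _.
  rewrite -ler_pdivlMl// linearB/=.
  have := hN n Nn; have := hN m Nm => /= /ltW hm /ltW hn.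
  have -> : f (u n) - f (u m) = (y - f (u m)) - (y - f (u n)).
    by rewrite opprB [RHS]addrC addrA subrK.
  apply: le_trans (ler_normB _ _) _; apply: le_trans (lerD hm hn) _.
  by rewrite le_eqVlt; apply/orP; left; apply/eqP; field; rewrite gt_eqF.
have fuc : (f \o u) @ \oo --> f c by apply: continuous_cvg => //; exact: cf.
exists c => //; rewrite -(cvg_lim (@norm_hausdorff _ _) fuc).
exact: (cvg_lim (@norm_hausdorff _ _) fu).
Qed.

End ell2_complete.

(** * Moments of indicators of intervals *)

Section moments_of_indicators.
Variable R : realType.
Local Notation mu := (@lebesgue_measure R).
Local Notation D := (`]0%R, 1%R[%classic : set R).

(** [moment_operatorE] integrates an arbitrary representative of the class; here it is exchanged for
    [f] itself, which agrees with it almost everywhere. *)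
Lemma moment_operator_class (f : LfunType (lebesgue01 R) (lee1n 2)) j :
  moment_operator (Lspace_class f) j = \int[mu]_(t in D) (t ^+ j * f t).
Proof.
rewrite moment_operatorE; congr fine; apply: ae_eq_integral => //.
- apply/measurable_EFinP; apply: measurable_funM; first exact: measurable_funTS.
  by apply: measurable_funTS; exact: measurable_Lspace.
- apply/measurable_EFinP; apply: measurable_funM; first exact: measurable_funTS.
  by apply: measurable_funTS; exact: measurable_funPT.
- apply: ae_lebesgue01; have e := Lspace_classE f.
  by apply: filterS e => t h; rewrite h.
Qed.

Lemma lebesgue01_itv (u v : R) : 0 <= u -> u <= v -> v <= 1 ->
  lebesgue01 R `]u, v[%classic = (v - u)%:E.
Proof.
move=> u0 uv v1; rewrite /lebesgue01/= /mrestr setIidl.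
  rewrite lebesgue_measure_itv/= lte_fin; case: ltP => // vu.
  have /eqP -> : v == u by rewrite eq_le vu uv.
  by rewrite subrr.
by apply: subset_itv; rewrite bnd_simp.
Qed.

Lemma integral_lebesgue01_indic (A : set (measurableTypeR R)) : measurable A ->
  (\int[lebesgue01 R]_t ((\1_A t : R) ^+ 2)%:E = lebesgue01 R A)%E.
Proof.
move=> mA; rewrite -[in RHS](setIT A) -integral_indic//; apply: eq_integral => t _.
by rewrite indicE; case: (_ \in _); rewrite ?expr1n ?expr0n.
Qed.

Lemma indic_itv_Lfun (u v : R) :
  (\1_(`]u, v[%classic : set (measurableTypeR R)) : measurableTypeR R -> R) \in
    Lfun (lebesgue01 R) 2%:E.
Proof.
have mI : measurable (`]u, v[%classic : set (measurableTypeR R)) by exact: measurable_itv.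
apply: sqr_integral_Lfun; first exact: measurable_indic.
rewrite integral_lebesgue01_indic//; apply: (@le_lt_trans _ _ (mu `]0, 1[%classic)).
  by rewrite /lebesgue01/= /mrestr; apply: le_measure; rewrite ?inE;
    [apply: measurableI|exact: measurable_itv|exact: subIsetr].
by rewrite lebesgue_measure_itv/= lte_fin ltr01 EFinN sube0 ltry.
Qed.

Definition itv_class (u v : R) : L2_01 R :=
  Lspace_class (Lfun_Sub (lee1n 2) (indic_itv_Lfun u v)).

Lemma moment_itv_class (u v : R) j : 0 <= u -> u <= v -> v <= 1 ->
  u ^+ j * (v - u) <= moment_operator (itv_class u v) j <= v ^+ j * (v - u).
Proof.
move=> u0 uv v1; rewrite moment_operator_class/=.
have mD : measurable (D : set (measurableTypeR R)) by exact: measurable_itv.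
have mI : measurable (`]u, v[%classic : set (measurableTypeR R)) by exact: measurable_itv.
have i1 : mu.-integrable D (EFin \o (\1_(`]u, v[%classic : set (measurableTypeR R)) : R -> R)).
  apply: integrable_lebesgue01; first exact: measurable_indic.
  have := Lfun2_integrable_sqr (indic_itv_Lfun u v); congr (integrable _ _ _).
  by apply/funext => t/=; rewrite indicE; case: (_ \in _); rewrite ?expr1n ?expr0n.
have I1 : \int[mu]_(t in D) (\1_(`]u, v[%classic : set (measurableTypeR R)) t : R) = v - u.
  rewrite /Rintegral -integral_lebesgue01; last exact/measurable_EFinP/measurable_indic.
  by rewrite integral_indic//= setIT lebesgue01_itv.
have iZ a : mu.-integrable D
    (EFin \o (fun t => a * (\1_(`]u, v[%classic : set (measurableTypeR R)) t : R))).
  by have := integrableZl mD a i1; congr (integrable _ _ _).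
have itv t : (\1_(`]u, v[%classic : set (measurableTypeR R)) t : R) != 0 -> u < t < v.
  by rewrite indicE; case: (boolP (t \in _)) => [/set_mem|]; rewrite ?eqxx//= in_itv.
(* Writing [v - u] as the integral of the indicator turns both bounds into pointwise comparisons of
   [t ^+ j] with its values at the ends. *)
rewrite -I1 -!RintegralZl//; apply/andP; split; apply: le_Rintegral => //;
  try exact: integrable_monoM.
- move=> t _; have [-> |/itv/andP[ut tv]] := eqVneq (\1_(`]u, v[%classic : set (measurableTypeR R)) t : R) 0.
    by rewrite !mulr0.
  by rewrite ler_wpM2r ?lerXn2r ?nnegrE//; lra.
- move=> t _; have [-> |/itv/andP[ut tv]] := eqVneq (\1_(`]u, v[%classic : set (measurableTypeR R)) t : R) 0.
    by rewrite !mulr0.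
  by rewrite ler_wpM2r ?lerXn2r ?nnegrE//; lra.
Qed.

End moments_of_indicators.

(** * The range is not closed *)

Section range_not_closed.
Variable R : realType.
Local Notation mu := (@lebesgue_measure R).
Local Notation D := (`]0%R, 1%R[%classic : set R).

Let mD : measurable (D : set (measurableTypeR R)). Proof. exact: measurable_itv. Qed.

Lemma integrable_L2_01 (x : L2_01 R) : mu.-integrable D (EFin \o (x : R -> R)).
Proof.
apply: integrable_lebesgue01; first exact: measurable_Lspace.
apply/Lfun1_integrable; apply: Lfun_subset12; last exact: Lspace_in_Lfun.
by rewrite /lebesgue01/= /mrestr setTI /= lebesgue_measure_itv/= lte_fin ltr01 EFinN sube0.
Qed.

Lemma delta0_notin_range : ~ range (@moment_operator R) (ell2_delta R 0).
Proof.
move=> [x _ Ax].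
have ix := integrable_L2_01 x.
(* Multiplying by [1 - t] turns the moments m_j into m_j - m_(j+1), an operation that fixes e_0. The
   induction on [n] therefore treats all [j] at once. *)
have h n j : mu.-integrable D (EFin \o (fun t => (1 - t) ^+ n * (t ^+ j * x t))) /\
    \int[mu]_(t in D) ((1 - t) ^+ n * (t ^+ j * x t)) = (j == 0)%:R.
  elim: n j => [|n ih] j.
    under [X in EFin \o X]eq_fun do rewrite expr0 mul1r.
    under eq_Rintegral do rewrite expr0 mul1r.
    by split; [exact: integrable_monoM | rewrite -moment_operatorE Ax ell2_deltaE].
  have [i1 e1] := ih j; have [i2 e2] := ih j.+1.
  have e t : (1 - t) ^+ n.+1 * (t ^+ j * x t) =
      (1 - t) ^+ n * (t ^+ j * x t) - (1 - t) ^+ n * (t ^+ j.+1 * x t).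
    by rewrite !exprS; ring.
  split; last by under eq_Rintegral do rewrite e; rewrite RintegralB// e1 e2 subr0.
  under [X in EFin \o X]eq_fun do rewrite e.
  have := integrableB mD i1 i2; by congr (integrable _ _ _).
(* [fine] sends infinite values to 0, so a real integral equal to 1 comes from an extended one equal
   to 1. *)
have h1 n : (\int[mu]_(t in D) ((1 - t) ^+ n * x t)%:E = 1)%E.
  have [i1] := h n 0%N; under eq_Rintegral do rewrite expr0 mul1r.
  rewrite eqxx /Rintegral; case: (integral _ _ _) => [r /= ->//||] /esym/eqP; by rewrite oner_eq0.
have [|//||||_ _] := @dominated_convergence _ _ _ mu D mD
  (fun n t => ((1 - t) ^+ n * x t)%:E) (fun=> 0%E) (fun t => `|x t|%:E).
- move=> n; apply/measurable_EFinP; apply: measurable_funM.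
    by apply: measurable_funX; exact: measurable_funB.
  by apply: measurable_funTS; exact: measurable_Lspace.
- apply: aeW => t /=; rewrite in_itv/= => /andP[t0 t1].
  apply: cvg_EFin; first exact: nearW.
  rewrite -(mul0r (x t)); apply: cvgM; last exact: cvg_cst.
  by apply: cvg_expr; rewrite ger0_norm; lra.
- by have := integrable_abse ix; congr (integrable _ _ _).
- apply: aeW => t n /=; rewrite in_itv/= => /andP[t0 t1].
  rewrite lee_fin normrM ler_piMl// normrX exprn_ile1// ger0_norm; lra.
rewrite integral0; under eq_fun do rewrite h1.
move=> /(cvg_lim (@ereal_hausdorff R)); rewrite lim_cst// => /eqP.
by rewrite onee_eq0.
Qed.

(** Coordinate 0 is exactly 1 and coordinate i >= 1 lies between 0 and b^i, where b = 1/(n + 2). The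
    shift by 2 gives b <= 1/2, so the squared error is at most b times a geometric series of sum at
    most 2. *)
Lemma delta0_limit :
  moment_operator (n.+2%:R *: itv_class 0 n.+2%:R^-1) @[n --> \oo] --> ell2_delta R 0.
Proof.
have norm_le n : `|moment_operator (n.+2%:R *: itv_class 0 n.+2%:R^-1) - ell2_delta R 0| ^+ 2
    <= 2 * n.+2%:R^-1.
  set b : R := n.+2%:R^-1.
  have b0 : 0 < b by rewrite invr_gt0.
  have b2 : b <= 2^-1 by rewrite lef_pV2 ?posrE// ler_nat.
  apply: ell2_norm_sqr_le => N.
  apply: (@le_trans _ _ (\sum_(j < N) b * b ^+ j)); last first.
    rewrite -mulr_sumr mulrC ler_wpM2r ?(ltW b0)//.
    apply: le_trans (geom_sum_le _ _) _; first by apply/andP; split; lra.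
    by rewrite -[leRHS]invrK lef_pV2 ?posrE; lra.
  apply: ler_sum => j _; rewrite ell2B ell2_deltaE linearZ_LR ell2Z.
  have b1 : b <= 1 by lra.
  have := moment_itv_class j (lexx 0) (ltW b0) b1; rewrite subr0.
  have -> : n.+2%:R = b^-1 by rewrite invrK.
  case: (j : nat) => [|i].
    (* For exponent 0 the two bounds of [moment_itv_class] coincide, so this coordinate has no
       error. *)
    rewrite !expr0 !mul1r => /le_anti <-; rewrite eqxx mulVf ?gt_eqF// subrr expr0n.
    by rewrite mulr1 ltW.
  rewrite expr0n mul0r mulr0n subr0 => /andP[m0 mb].
  have k0 : 0 <= b^-1 * moment_operator (itv_class 0 b) i.+1.
    by rewrite mulr_ge0// invr_ge0 ltW.
  have k1 : b^-1 * moment_operator (itv_class 0 b) i.+1 <= b ^+ i.+1.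
    by rewrite mulrC ler_pdivrMr.
  apply: (@le_trans _ _ ((b ^+ i.+1) ^+ 2)); first by rewrite lerXn2r ?nnegrE// exprn_ge0// ltW.
  rewrite expr2 ler_wpM2r ?exprn_ge0 ?(ltW b0)//.
  by rewrite exprS ler_piMr ?(ltW b0)// exprn_ile1// ltW.
apply/cvgrPdist_le => e e0.
have : (n.+1%:R^-1 : R) @[n --> \oo] --> (0 : R) by exact: cvg_harmonic.
move=> /cvgrPdist_lt /(_ (e ^+ 2 / 2)); rewrite divr_gt0 ?exprn_gt0// => /(_ isT).
move=> [N _ hN]; exists N => //= n Nn.
have := hN n.+1 (leqW Nn) => /=; rewrite sub0r normrN ger0_norm ?invr_ge0// => hn.
rewrite distrC -ler_sqr ?nnegrE ?(ltW e0)//; apply: le_trans (norm_le n) _.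
by rewrite mulrC -ler_pdivlMr// ltW.
Qed.

Lemma moment_operator_ill_posed : ill_posed (@moment_operator R).
Proof.
move=> cl; apply: delta0_notin_range.
by apply: (closed_cvg (range (@moment_operator R)) cl _ _ delta0_limit);
  apply: nearW => n; eexists.
Qed.

End range_not_closed.

(** * Disjoint blocks near 1 and their synthesis operator *)

Section block_functions.
Variable R : realType.

(** Small enough that [16^-1 - 5 * q], the constant that [almost_orthogonal_le] will give, is
    positive. *)
Let q : R := 128^-1.

(** The factor [2^-1] keeps the left end of block 0 nonnegative. *)
Definition block_scale (k : nat) : R := 2^-1 * q ^+ k.
Local Notation p := block_scale.

Let q01 : 0 < q <= 2^-1.
Proof. by rewrite /q; apply/andP; split; lra. Qed.

Let qX_le1 n : q ^+ n <= 1.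
Proof. by apply: exprn_ile1; rewrite /q; lra. Qed.

Lemma block_scale_gt0 k : 0 < p k.
Proof. by case/andP: q01 => q0 _; rewrite mulr_gt0// exprn_gt0. Qed.

Lemma block_scale_le k : p k <= 2^-1.
Proof.
by rewrite ler_piMr.
Qed.

Lemma block_scaleB k l : (l <= k)%N -> p k = q ^+ (k - l) * p l.
Proof. by move=> lk; rewrite /p mulrCA -exprD subnK. Qed.

Definition block (k : nat) : set (measurableTypeR R) :=
  `]1 - 2 * p k ^+ 2, 1 - p k ^+ 2[%classic.

Lemma block_bounds k :
  [/\ 0 <= 1 - 2 * p k ^+ 2, 1 - 2 * p k ^+ 2 <= 1 - p k ^+ 2 & 1 - p k ^+ 2 < 1].
Proof.
have := block_scale_le k; have := block_scale_gt0 k; move: (p k) => u u0 u1.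
have : 0 < u ^+ 2 by rewrite exprn_gt0.
have : 0 <= (2^-1 - u) * (2^-1 + u) by apply: mulr_ge0; lra.
by split; rewrite ?expr2; lra.
Qed.

(** The scales at least halve at each step, so for k < l the right end 1 - p_k^2 of block k lies
    below the left end 1 - 2 p_l^2 of block l. *)
Lemma block_inj k l (t : R) : block k t -> block l t -> k = l.
Proof.
wlog kl : k l / (k < l)%N => [h bk bl|].
  by case: (ltngtP k l) => // kl; [exact: h | apply/esym; exact: h].
rewrite /block/= !in_itv/= => /andP[_ tk] /andP[tl _]; exfalso.
have p0 := block_scale_gt0 k; have pl0 := block_scale_gt0 l.
have : p l <= 2^-1 * p k.
  rewrite (block_scaleB (ltnW kl)) ler_wpM2r ?(ltW p0)//.
  case/andP: q01 => q0 q1; rewrite -(prednK (_ : 0 < l - k)%N) ?subn_gt0// exprS.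
  by apply: le_trans _ q1; rewrite ler_piMr ?(ltW q0).
nra.
Qed.

Lemma measurable_block k : measurable (block k).
Proof. exact: measurable_itv. Qed.

Lemma lebesgue01_block k : lebesgue01 R (block k) = (p k ^+ 2)%:E.
Proof.
have [h0 h1 h2] := block_bounds k.
by rewrite /block lebesgue01_itv ?(ltW h2)//; congr EFin; ring.
Qed.

Definition block_fun (k : nat) (t : measurableTypeR R) : R := (p k)^-1 * \1_(block k) t.

(* Outside all the blocks the index is the junk value 0, where [block_fun 0]
   vanishes. *)
Definition block_index (t : measurableTypeR R) : nat := xget 0%N [set k | block k t].

(** By disjointness at most one term of the series of [c k * block_fun k t] is nonzero at each [t];
    selecting it defines the sum pointwise, for any [c]. *)
Definition block_series (c : nat -> R) (t : measurableTypeR R) : R :=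
  c (block_index t) * block_fun (block_index t) t.

Lemma block_fun_eq0 k t : k != block_index t -> block_fun k t = 0.
Proof.
move=> kt; rewrite /block_fun indicE; case: (boolP (t \in _)) => [/set_mem bk|].
  case/negP: kt; apply/eqP; rewrite /block_index.
  by case: xgetP => [l _ /(block_inj bk)//|/(_ k)].
by rewrite mulr0.
Qed.

Lemma block_series_sum (c : nat -> R) n t : (block_index t < n)%N ->
  \sum_(k < n) c k * block_fun k t = block_series c t.
Proof.
move=> tn; rewrite (bigD1 (Ordinal tn))//= big1 ?addr0// => k.
by rewrite -val_eqE/= => /block_fun_eq0 ->; rewrite mulr0.
Qed.

Lemma measurable_block_fun k : measurable_fun [set: measurableTypeR R] (block_fun k).
Proof.
by apply: measurable_funM; [exact: measurable_cst | exact: measurable_indic (measurable_block k)].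
Qed.

Lemma measurable_block_series (c : nat -> R) : measurable_fun [set: measurableTypeR R] (block_series c).
Proof.
apply: (@measurable_fun_cvg _ _ _ _ (fun n t => \sum_(k < n) c k * block_fun k t)).
  move=> n; apply: measurable_sum => k.
  by apply: measurable_funM; [exact: measurable_cst | exact: measurable_block_fun].
move=> t _; apply: cvg_near_cst; exists (block_index t).+1 => //= n tn.
exact: block_series_sum.
Qed.

(** Disjoint supports make the square of the series the series of squares, which is integrated
    termwise by nonnegativity; the length p_k^2 of block k cancels the normalization. *)
Lemma integral_sqr_block_series (c : nat -> R) :
  (\int[lebesgue01 R]_t (block_series c t ^+ 2)%:E = \sum_(k <oo) (c k ^+ 2)%:E)%E.
Proof.
have sqr0 (r : R) : (0 <= (r ^+ 2)%:E)%E by rewrite lee_fin sqr_ge0.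
under eq_integral => t _.
  have -> : (block_series c t ^+ 2)%:E = (\sum_(k <oo) ((c k * block_fun k t) ^+ 2)%:E)%E.
    rewrite (@nneseriesD1 _ _ (block_index t) xpredT)// eseries0 ?adde0// => k _ /andP[_ kt].
    by rewrite block_fun_eq0// mulr0 expr0n.
  over.
rewrite integral_nneseries//; last first.
  move=> k; apply/measurable_EFinP; apply: measurable_funX; apply: measurable_funM => //.
  exact: measurable_block_fun.
apply: eq_eseriesr => k _.
have p0 := block_scale_gt0 k; have mb := measurable_block k.
under eq_integral => t _.
  rewrite /block_fun mulrA exprMn EFinM; over.
rewrite ge0_integralZl_EFin//; last first.
- exact: sqr_ge0.
- by apply/measurable_EFinP; apply: measurable_funX; exact: measurable_indic.
rewrite integral_lebesgue01_indic// lebesgue01_block -EFinM.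
by congr EFin; field; rewrite gt_eqF.
Qed.

Lemma block_series_Lfun (c : ell2 R) : block_series c \in Lfun (lebesgue01 R) 2%:E.
Proof.
apply: sqr_integral_Lfun; first exact: measurable_block_series.
by rewrite integral_sqr_block_series -ell2_norm_sqr ltry.
Qed.

(** The isometry from coefficient sequences onto the closed span of the orthonormal block
    functions. *)
Definition block_synthesis (c : ell2 R) : L2_01 R :=
  Lspace_class (Lfun_Sub (lee1n 2) (block_series_Lfun c)).

Lemma block_synthesis_norm c : `|block_synthesis c| = `|c|.
Proof.
apply/eqP; rewrite -(@eqrXn2 _ 2)// -eqe; apply/eqP.
by rewrite Lspace2_class_norm_sqr/= integral_sqr_block_series ell2_norm_sqr.
Qed.

Lemma block_synthesisE c :
  (block_synthesis c : _ -> R) = block_series c %[ae lebesgue01 R].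
Proof. exact: Lspace_classE. Qed.

Lemma block_synthesis_linear : linear block_synthesis.
Proof.
move=> a x y; apply/LspaceP.
have e1 := block_synthesisE (a *: x + y).
have e2 := block_synthesisE x.
have e3 := block_synthesisE y.
have e4 := Lspace_addE (a *: block_synthesis x) (block_synthesis y).
have e5 := Lspace_scaleE a (block_synthesis x).
apply: filterS3 e1 (filterI e2 e3) (filterI e4 e5) => t h1 [h2 h3] [h4 h5] Tt.
rewrite (h1 Tt) (h4 Tt) (h5 Tt) (h2 Tt) (h3 Tt) /block_series.
by rewrite ell2D ell2Z mulrDl -mulrA.
Qed.

HB.instance Definition _ := GRing.isLinear.Build R (ell2 R) (L2_01 R) _
  block_synthesis block_synthesis_linear.

Lemma block_synthesis_continuous : continuous block_synthesis.
Proof.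
apply: bounded_linear_continuous; apply/linear_boundedP.
exists 1; split => // M M1 x.
by rewrite block_synthesis_norm ler_peMl// ltW.
Qed.

Lemma block_synthesis_delta k : block_synthesis (ell2_delta R k) =
  (p k)^-1 *: itv_class (1 - 2 * p k ^+ 2) (1 - p k ^+ 2).
Proof.
apply/LspaceP; set I := itv_class _ _.
have e1 := block_synthesisE (ell2_delta R k).
have e2 := Lspace_scaleE (p k)^-1 I.
have e3 : (I : _ -> R) = \1_(block k) %[ae lebesgue01 R] by exact: Lspace_classE.
apply: filterS3 e1 e2 e3 => t h1 h2 h3 Tt.
rewrite (h1 Tt) (h2 Tt) (h3 Tt) /block_series ell2_deltaE.
have [->|kt] := eqVneq (block_index t) k; first by rewrite mul1r.
by rewrite mul0r; apply/esym/(@block_fun_eq0 k t); rewrite eq_sym.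
Qed.

(** * Moments of the block functions and the lower bound on their span *)

Let a k j : R := moment_operator (block_synthesis (ell2_delta R k)) j.

Lemma block_moment_bounds k j :
  (1 - 2 * p k ^+ 2) ^+ j * p k <= a k j <= (1 - p k ^+ 2) ^+ j * p k.
Proof.
have [h0 h1 h2] := block_bounds k; have p0 := block_scale_gt0 k.
have := moment_itv_class j h0 h1 (ltW h2).
rewrite /a block_synthesis_delta [moment_operator (_ *: _)]linearZ_LR ell2Z.
rewrite (_ : 1 - p k ^+ 2 - (1 - 2 * p k ^+ 2) = p k ^+ 2); last by ring.
by rewrite ler_pdivlMl// ler_pdivrMl// expr2 !mulrA ![p k * _]mulrC !mulrA.
Qed.

Lemma block_moment_ge0 k j : 0 <= a k j.
Proof.
have /andP[h _] := block_moment_bounds k j; apply: le_trans _ h.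
by have [h0 _ _] := block_bounds k; rewrite mulr_ge0 ?exprn_ge0// ltW// block_scale_gt0.
Qed.

(** Up to N = (128^2)^k, where N p_k^2 = 1/4, Bernoulli's inequality keeps (1 - 2 p_k^2)^j above
    1/2. The first N squares are thus at least p_k^2 / 4 each, and N p_k^2 / 4 = 1/16. *)
Lemma block_moment_diag k m : ((128 ^ 2) ^ k <= m)%N ->
  16^-1 <= \sum_(j < m) a k j ^+ 2.
Proof.
set N := (_ ^ k)%N => Nm; have p0 := block_scale_gt0 k.
have Np : N%:R * p k ^+ 2 = 4^-1.
  have N0 : N%:R != 0 :> R by rewrite pnatr_eq0 /N !expn_eq0.
  have -> : p k ^+ 2 = 4^-1 * N%:R^-1.
    rewrite exprMn /q exprAC !exprVn /N !natrX; congr (_^-1 * _).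
    by ring.
  by rewrite mulrCA divff ?mulr1.
rewrite -(big_mkord xpredT (fun j => a k j ^+ 2)) (big_cat_nat (leq0n N) Nm)/=.
rewrite -[leLHS]addr0; apply: lerD; last by apply: sumr_ge0 => j _; exact: sqr_ge0.
apply: (@le_trans _ _ (\sum_(0 <= j < N) (2^-1 * p k) ^+ 2)).
  rewrite sumr_const_nat subn0 -[leRHS]mulr_natl exprMn mulrCA Np.
  by rewrite le_eqVlt; apply/orP; left; apply/eqP; field.
apply: ler_sum_nat => j /andP[_ jN].
have /andP[h _] := block_moment_bounds k j.
have half0 : 0 <= 2^-1 * p k by apply: mulr_ge0 => //; exact: ltW.
rewrite lerXn2r ?nnegrE ?block_moment_ge0//.
apply: le_trans _ h; rewrite ler_wpM2r ?(ltW p0)//.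
have [h0 h1 h2] := block_bounds k.
apply: le_trans _ (bernoulli_le j _); last first.
  by rewrite mulr_ge0 ?sqr_ge0//=; rewrite -subr_ge0.
have : j%:R * p k ^+ 2 <= 4^-1.
  by rewrite -Np ler_wpM2r ?sqr_ge0// ler_nat ltnW.
rewrite [j%:R * (2 * _)]mulrCA; move: (j%:R * p k ^+ 2) => z; lra.
Qed.

(** The moments of the wider block [l] decay faster: keeping only this decay and bounding those of
    block [k] by p_k leaves a geometric series of sum at most p_l^-2, hence the bound p_k / p_l. *)
Lemma block_moment_offdiag k l m : (l <= k)%N ->
  `|\sum_(j < m) a k j * a l j| <= q ^+ (k - l).
Proof.
move=> lk; have pk0 := block_scale_gt0 k; have pl0 := block_scale_gt0 l.
have [h0 h1 h2] := block_bounds l; have [k0 k1 k2] := block_bounds k.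
rewrite ger0_norm; last by apply: sumr_ge0 => j _; rewrite mulr_ge0 ?block_moment_ge0.
apply: (@le_trans _ _ (\sum_(j < m) p k * p l * (1 - p l ^+ 2) ^+ j)).
  apply: ler_sum => j _.
  have /andP[_ hk] := block_moment_bounds k j; have /andP[_ hl] := block_moment_bounds l j.
  rewrite -mulrA [p l * _]mulrC ler_pM ?block_moment_ge0//.
  apply: le_trans hk _; rewrite ler_piMl ?(ltW pk0)// exprn_ile1 ?(ltW k2)//.
  exact: le_trans k0 k1.
rewrite -mulr_sumr.
apply: (@le_trans _ _ (p k * p l * (p l ^+ 2)^-1)).
  apply: ler_wpM2l; first exact: mulr_ge0 (ltW pk0) (ltW pl0).
  apply: le_trans (geom_sum_le _ _) _; first by rewrite h2 andbT; exact: le_trans h0 h1.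
  by rewrite opprB addrC subrK.
rewrite le_eqVlt; apply/orP; left; apply/eqP.
by rewrite (block_scaleB lk); field; rewrite gt_eqF.
Qed.

Lemma sum_sqr_le_block_moments (c : nat -> R) n :
  \sum_(k < n) c k ^+ 2 <=
  64 * `|moment_operator (block_synthesis (\sum_(k < n) c k *: ell2_delta R k))| ^+ 2.
Proof.
(* This cutoff exceeds the thresholds of [block_moment_diag] for all k < n. *)
pose m := ((128 ^ 2) ^ n)%N.
have h : (16^-1 - 5 * q) * \sum_(k < n) c k ^+ 2 <=
    \sum_(j < m) (\sum_(k < n) c k * a k j) ^+ 2.
  apply: almost_orthogonal_le; first exact: q01.
  - by move=> k kn; apply: block_moment_diag; rewrite leq_pexp2l// ltnW.
  - by move=> k l /andP[lk _]; apply: block_moment_offdiag; exact: ltnW.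
have h' : \sum_(j < m) (\sum_(k < n) c k * a k j) ^+ 2 <=
    `|moment_operator (block_synthesis (\sum_(k < n) c k *: ell2_delta R k))| ^+ 2.
  apply: le_trans _ (sum_sqr_le_ell2_norm _ m); apply: ler_sum => j _.
  rewrite !linear_sum ell2_sum.
  by under [in leRHS]eq_bigr do rewrite !linearZ_LR ell2Z.
(* The constant [16^-1 - 5 * q] equals 3/128, and 64 times it is at least 1. *)
have : 0 <= \sum_(k < n) c k ^+ 2 by apply: sumr_ge0 => k _; exact: sqr_ge0.
move: h h'; move: (\sum_(k < n) c k ^+ 2) (\sum_(j < m) _) => S1 S2.
by move: (`|_| ^+ 2) => S3; rewrite /q; lra.
Qed.

Lemma moment_block_synthesis_continuous :
  continuous (fun c => moment_operator (block_synthesis c)).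
Proof.
move=> c; apply: continuous_comp; first exact: block_synthesis_continuous.
exact: moment_operator_continuous.
Qed.

(** The bound for finite sums passes to the limit along truncations of [c] by continuity; 8 is the
    square root of 64. *)
Lemma norm_le_moment_block_synthesis (c : ell2 R) :
  `|c| <= 8 * `|moment_operator (block_synthesis c)|.
Proof.
rewrite -ler_sqr ?nnegrE ?mulr_ge0// exprMn; apply: ell2_norm_sqr_le => m.
have lim : 8 ^+ 2 *
    `|moment_operator (block_synthesis (\sum_(k < n) c k *: ell2_delta R k))| ^+ 2
    @[n --> \oo] --> 8 ^+ 2 * `|moment_operator (block_synthesis c)| ^+ 2.
  apply: cvgMr; have h : `|moment_operator (block_synthesis
      (\sum_(k < n) c k *: ell2_delta R k))| @[n --> \oo] -->
      `|moment_operator (block_synthesis c)|.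
    pose g c := moment_operator (block_synthesis c).
    have g_cvg : (g \o (fun n => \sum_(k < n) c k *: ell2_delta R k)) @ \oo --> g c.
      apply: continuous_cvg; last exact: ell2_truncation_cvg.
      exact: moment_block_synthesis_continuous.
    exact: (cvg_norm g_cvg).
  exact: (cvgM h h).
rewrite -(cvg_lim _ lim)//; apply: limr_ge; first by apply/cvg_ex; eexists; exact: lim.
exists m => //= n mn.
rewrite (_ : 8 ^+ 2 = 64); last by ring.
apply: le_trans _ (sum_sqr_le_block_moments _ _).
rewrite -!(big_mkord xpredT (fun k => c k ^+ 2)) (big_cat_nat (leq0n m) mn)/= lerDl.
by apply: sumr_ge0 => j _; exact: sqr_ge0.
Qed.

End block_functions.

(** * Infinite dimension and conclusion *)

(** If [n] vectors spanned the range, the coefficient matrix of the images of [n.+1] unit vectors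
    would have more rows than columns; a nonzero row of its left kernel gives a nonzero combination
    of unit vectors with image 0. *)
Lemma range_ell2_infinite_dimensional (R : realType) (Y : normedModType R)
    (f : {linear ell2 R -> Y}) : injective f -> ~ finite_dimensional (range f).
Proof.
move=> f_inj [n [v fv]].
have : forall i : 'I_n.+1, exists c : 'I_n -> R,
    f (ell2_delta R i) = \sum_(j < n) c j *: v j.
  move=> i; have : range f (f (ell2_delta R i)) by exists (ell2_delta R i).
  by rewrite fv => -[c _ <-]; exists c.
move=> /choice[C fC].
pose M := \matrix_(i < n.+1, j < n) C i j.
have ker0 : kermx M != 0.
  rewrite -mxrank_eq0 mxrank_ker subn_eq0 -ltnNge ltnS.
  exact: rank_leq_col.
pose u := nz_row (kermx M).
have uM : u *m M = 0 by apply/sub_kermxP; exact: nz_row_sub.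
have u0 : u != 0 by rewrite nz_row_eq0.
(* [inord] extends the row [u] to a function on [nat], the form that [sum_ell2_delta] takes. *)
have fu : f (\sum_(k < n.+1) u 0 (inord k) *: ell2_delta R k) = f 0.
  rewrite linear0 linear_sum.
  under eq_bigr => i _.
    rewrite linearZ_LR fC inord_val scaler_sumr.
    under eq_bigr do rewrite scalerA.
    over.
  rewrite exchange_big/= big1// => j _.
  rewrite -scaler_suml; have /rowP/(_ j) := uM; rewrite !mxE => uj.
  by under eq_bigr do [rewrite -[C _ _](mxE matrix_key (fun i j => C i j))]; rewrite uj scale0r.
case/eqP: u0; apply/rowP => i; rewrite mxE.
have := f_inj _ _ fu => /(congr1 (fun y : ell2 R => y i)).
by rewrite (@sum_ell2_delta R n.+1 (fun k => u 0 (inord k))) ltn_ord inord_val ell2_0.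
Qed.

Theorem proposition6 (R : realType) : ill_posed_type_I (@moment_operator R).
Proof.
split; first exact: moment_operator_ill_posed.
(* The subspace is [range f], the image of the closed span of the blocks; the lower bound [f_ge]
   yields both injectivity and closedness. *)
pose f : {linear ell2 R -> ell2 R} := @moment_operator R \o @block_synthesis R.
have f_ge c : `|c| <= 8 * `|f c| by exact: norm_le_moment_block_synthesis.
have f_inj : injective f.
  move=> x y fxy; apply/eqP; rewrite -subr_eq0 -normr_le0.
  by apply: le_trans (f_ge _) _; rewrite linearB fxy subrr normr0 mulr0.
exists (range f); split.
- split; first by rewrite inE; exists 0; rewrite ?linear0.
  move=> a y z; rewrite !inE => -[b _ <-] [c _ <-].
  by exists (a *: b + c); rewrite ?linearP.
- apply: (@closed_range_ell2 _ _ f 8 _ f_ge).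
  exact: moment_block_synthesis_continuous.
- exact: range_ell2_infinite_dimensional.
- by move=> _ [c _ <-]; exists (block_synthesis c).
Qed.
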